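(* Let $\Gamma=(X,R)$ be a connected $k$-regular graph on $n=|X|$ vertices, with adjacency matrix $A$ having distinct eigenvalues $\lambda_0=k>\lambda_1>\cdots>\lambda_d$ with respective multiplicities $m_i=m(\lambda_i)$, diameter $D$, and predistance polynomials $p_0,\ldots,p_d$. Let $\phi_i=\prod_{j\ne i}(\lambda_i-\lambda_j)$ for $i=0,\ldots,d$, and let $q_{d-1}=p_0+\cdots+p_{d-1}$. Then the following hold. (i) In general, $$\frac1{|X|}\sum_{x\in X}\bigl(|X|-|\Gamma_D(x)|\bigr)\ \ge\ |X|-\sum_{i=D}^d p_i(k),$$ with equality if and only if $A_D=\sum_{i=D}^d p_i(A)$. (ii) If $A_D\in\operatorname{span}\{I,A,\ldots,A^d\}$, then $|\Gamma_D(x)|\le\sum_{i=D}^d p_i(k)$ for every $x\in X$. (iii) If $\frac1{|X|}\sum_{x\in X}(|X|-|\Gamma_D(x)|)=|X|-\sum_{i=D}^d p_i(k)$, then $A_D\in\operatorname{span}\{I,A,\ldots,A^d\}$. (iv) $\Gamma$ is distance-regular if and only if $D=d$ and $$\frac{|X|}{\sum_{x\in X}\frac{1}{|X|-|\Gamma_d(x)|}}=q_{d-1}(k)=|X|-p_d(k)=n\left[1-\left(\sum_{i=0}^d\frac{\phi_0^2}{m_i\phi_i^2}\right)^{-1}\right],$$ or, alternatively, if and only if $D=d$ and $$\frac1{|X|}\sum_{x\in X}\bigl(|X|-|\Gamma_D(x)|\bigr)=|X|-p_d(k)=n\left[1-\left(\sum_{i=0}^d\frac{\phi_0^2}{m_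i\phi_i^2}\right)^{-1}\right].$$
   Context: Graphs are finite, simple, undirected, connected, with vertex set $X$, $n=|X|\ge 2$. For $x\in X$, $\Gamma_i(x)$ is the set of vertices at distance exactly $i$ from $x$. $D$ is the diameter, and $A_D$ is the $X\times X$ distance-$D$ matrix: $(A_D)_{xy}=1$ if $x,y$ are at distance $D$, and $0$ otherwise. A connected graph is distance-regular if for all $h,i,j$ the number of vertices $z$ at distance $i$ from $x$ and $j$ from $y$ depends only on $h,i,j$ whenever $x,y$ are at distance $h$. On the real polynomials of degree at most $d$ consider the scalar product $$\langle f,g\rangle_A=\frac1n\operatorname{tr}(f(A)g(A))=\frac1n\sum_{i=0}^d m(\lambda_i)f(\lambda_i)g(\lambda_i).$$ The predistance polynomials $p_0,\ldots,p_d$ are the unique sequence of polynomials with $\deg p_i=i$, pairwise orthogonal for $\langle\cdot,\cdot\rangle_A$, normalized so that $\|p_i\|_A^2=\langle p_i,p_i\rangle_A=p_i(\lambda_0)$. *)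

(* Defs.v *)
From mathcomp Require Export all_boot all_order all_algebra.

Set Implicit Arguments.
Unset Strict Implicit.
Unset Printing Implicit Defensive.

Export Order.TTheory GRing.Theory Num.Theory.
Global Open Scope ring_scope.

Section Graph.
Variables (X : finType) (e : rel X).

Definition has_walk (x y : X) (l : nat) : bool :=
  [exists w : l.-tuple X, path e x w && (last x w == y)].

(* Length of a shortest walk. In a connected graph distances are < #|X|;
   the value would be #|X| for vertices in different components. *)
Definition gdist (x y : X) : nat := find (has_walk x y) (iota 0 #|X|).

Definition diam : nat := (\max_(x : X) \max_(y : X) gdist x y)%N.

Definition sphere (i : nat) (x : X) : {set X} := [set y | gdist x y == i].

Definition distance_regular : Prop :=
  (forall x y, connect e x y) /\
  exists c : nat -> nat -> nat -> nat, forall h i j x y,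
    gdist x y = h -> #|sphere i x :&: sphere j y| = c h i j.

(* Rows and columns are indexed by X through enum_val : 'I_#|X| -> X. *)
Definition adjmx (R : pzSemiRingType) : 'M[R]_#|X| :=
  \matrix_(i, j) (e (enum_val i) (enum_val j))%:R.

Definition distmx (R : pzSemiRingType) (h : nat) : 'M[R]_#|X| :=
  \matrix_(i, j) (gdist (enum_val i) (enum_val j) == h)%:R.

End Graph.

(* horner_mx is only available in dimension n.+1, hence not in dimension #|X|. *)
Definition pevalmx (R : comNzRingType) n (p : {poly R}) (A : 'M[R]_n) : 'M[R]_n :=
  \sum_(i < size p) p`_i *: A ^+ i.

Lemma pevalmxE (R : comNzRingType) n (p : {poly R}) (A : 'M[R]_n.+1) :
  pevalmx p A = horner_mx A p.
Proof.
rewrite -[in RHS](coefK p) poly_def rmorph_sum /=; apply: eq_bigr => i _.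
by rewrite horner_mxZ rmorphXn /= horner_mx_X.
Qed.

Definition mxdot (R : fieldType) n (A : 'M[R]_n) (f g : {poly R}) : R :=
  n%:R^-1 * \tr (pevalmx f A *m pevalmx g A).

(* The geometric multiplicity, which for a symmetric real matrix is also the
   algebraic one. *)
Definition mult (R : fieldType) n (A : 'M[R]_n) (a : R) : nat :=
  \rank (eigenspace A a).

Definition is_spectrum (R : rcfType) n (A : 'M[R]_n) d (lam : 'I_d.+1 -> R) :=
  (forall i j : 'I_d.+1, (i < j)%N -> lam j < lam i) /\
  (forall a : R, eigenvalue A a <-> exists i, a = lam i).

Definition predistance (R : rcfType) n (A : 'M[R]_n) d
    (lam : 'I_d.+1 -> R) (p : 'I_d.+1 -> {poly R}) : Prop :=
  [/\ forall i, size (p i) = i.+1,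
      forall i j, i != j -> mxdot A (p i) (p j) = 0
    & forall i, mxdot A (p i) (p i) = (p i).[lam ord0]].

Definition phi (R : comNzRingType) d (lam : 'I_d.+1 -> R) (i : 'I_d.+1) : R :=
  \prod_(j < d.+1 | j != i) (lam i - lam j).

(* Main.v *)
Require Import Defs.
From mathcomp Require Import sesquilinear spectral complex ring.

Set Implicit Arguments.
Unset Strict Implicit.
Unset Printing Implicit Defensive.

(** Matrices carry the scalar product <M, N> = n^-1 * sum_(i,j) M_ij N_ij, which
on polynomials in the symmetric matrix A is the scalar product of the statement.
Two families are compared in it: the distance matrices A_0, ..., A_D, which are
orthogonal because their supports partition the entries, and the matrices
p_0(A), ..., p_d(A), which form an orthogonal basis of the polynomials in A.
Both families sum to the all-ones matrix J, the second one because f |-> f(k)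
is represented by p_0 + ... + p_d as well as by Hoffman's polynomial, whose
value at A is J ([sum_predistance_const]).

(i) Let S be the sum of the p_i(A) with i >= D. A polynomial of degree < D in A
vanishes at every pair of vertices at distance D, so <A_D, S> = <A_D, J>, the
average of |Gamma_D(x)|, which is also <A_D, A_D>; and <S, S> is the sum of the
p_i(k) with i >= D. Hence |A_D - S|^2 is the difference of the two sides
([excess_gap]), which gives the inequality and its equality case. The inequality
also forces D <= d, since otherwise S = 0 while some vertex has a vertex at
distance D. Claim (iii) is immediate from the equality case.

(ii) The row sums of f(A) all equal f(k), so if A_D = f(A) then |Gamma_D(x)| does
not depend on x and (i) bounds its average.

(iv) If D = d and A_d = p_d(A), the three-term recurrence run downwards gives
p_i(A) = A_i for all i ([predistance_distmx]); then A_i A_j is a combination of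
the A_h, whose coefficients are the intersection numbers. Conversely, in a
distance-regular graph the span of A_0, ..., A_D is stable under A, hence
contains the (d+1)-dimensional span of the powers of A; as D <= d they coincide,
so that A_d is a polynomial in A orthogonal to all those of degree < d, that is,
a multiple of p_d(A), and the multiple is 1 by <A_d, A_d> = <A_d, J>. With the
equality case of (i) this settles the criterion with the arithmetic mean.

The harmonic mean is at most the arithmetic mean, so the criterion with the
harmonic mean needs a further argument. Row x of r = q_{d-1}(A) has sum
q_{d-1}(k) and is supported on the |X| - |Gamma_d(x)| vertices at distance < d
from x; by Cauchy-Schwarz its squared norm is at least
q_{d-1}(k)^2 / (|X| - |Gamma_d(x)|). The assumption says that equality holds after
summing over x, hence in each row: r is constant on those vertices. For d > 1
they include the neighbours of x, so by symmetry of r and connectedness the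
constant does not depend on x, and neither does |Gamma_d(x)|; for d = 1 this
number is k ([harmonic_constant]). So both means agree.

The closed form of p_d(k) comes from the orthogonality of p_d to the differences
of the monic polynomials prod_(l != i) (X - lambda_l), which determines p_d on the
spectrum up to the factor p_d(k) ([predistance_last_horner]); that factor is then
given by |p_d|^2 = p_d(k). *)

(** * Polynomials in a square matrix *)

Section PolynomialsInAMatrix.
Variables (R : comNzRingType) (n : nat) (A : 'M[R]_n).
Implicit Types f g : {poly R}.

Lemma pevalmxD f g : pevalmx (f + g) A = pevalmx f A + pevalmx g A.
Proof.
case: n A => [|n'] B; first by apply/matrixP => -[].
by rewrite !pevalmxE rmorphD.
Qed.

Lemma pevalmxZ c f : pevalmx (c *: f) A = c *: pevalmx f A.
Proof.
case: n A => [|n'] B; first by apply/matrixP => -[].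
by rewrite !pevalmxE horner_mxZ.
Qed.

Lemma pevalmxB f g : pevalmx (f - g) A = pevalmx f A - pevalmx g A.
Proof. by rewrite -!scaleN1r pevalmxD pevalmxZ. Qed.

Lemma pevalmx0 : pevalmx 0 A = 0.
Proof. by rewrite /pevalmx size_poly0 big_ord0. Qed.

Lemma pevalmx_sum (I : Type) (r : seq I) (P : pred I) (F : I -> {poly R}) :
  pevalmx (\sum_(i <- r | P i) F i) A = \sum_(i <- r | P i) pevalmx (F i) A.
Proof.
by apply: (big_morph (fun f => pevalmx f A)) => [f g|];
  rewrite ?pevalmxD ?pevalmx0.
Qed.

Lemma pevalmxM f g : pevalmx (f * g) A = pevalmx f A *m pevalmx g A.
Proof.
case: n A => [|n'] B; first by apply/matrixP => -[].
by rewrite !pevalmxE rmorphM.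
Qed.

Lemma pevalmxX : pevalmx 'X A = A.
Proof.
case: n A => [|n'] B; first by apply/matrixP => -[].
by rewrite !pevalmxE horner_mx_X.
Qed.

Lemma pevalmxXn i : pevalmx 'X^i A = A ^+ i.
Proof.
case: n A => [|n'] B; first by apply/matrixP => -[].
by rewrite !pevalmxE rmorphXn /= horner_mx_X.
Qed.

Lemma tr_pevalmx f : A^T = A -> (pevalmx f A)^T = pevalmx f A.
Proof.
move=> symA; rewrite /pevalmx linear_sum; apply: eq_bigr => i _ /=.
rewrite linearZ /=; congr (_ *: _).
elim: (val i) => [|j IH]; first by rewrite !expr0 trmx1.
by rewrite exprSr trmx_mul IH symA -exprSr exprS.
Qed.

Lemma pevalmx_eigen m (v : 'M[R]_(m, n)) a f :
  v *m A = a *: v -> v *m pevalmx f A = f.[a] *: v.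
Proof.
move=> vA; rewrite /pevalmx mulmx_sumr horner_coef scaler_suml.
apply: eq_bigr => i _; rewrite -scalemxAr -scalerA; congr (_ *: _).
elim: (val i) => [|j IH]; first by rewrite !expr0 mulmx1 scale1r.
by rewrite exprSr -[A ^+ j * A]/(A ^+ j *m A) mulmxA IH -scalemxAl vA scalerA exprSr.
Qed.
End PolynomialsInAMatrix.

(** * The normalized entrywise scalar product *)

Section MatrixScalarProduct.
Variables (R : realFieldType) (n : nat).
Implicit Types M N : 'M[R]_n.

Definition mdot M N : R := n%:R^-1 * \sum_i \sum_j M i j * N i j.

Lemma mdotC M N : mdot M N = mdot N M.
Proof.
congr (_ * _); apply: eq_bigr => i _; apply: eq_bigr => j _; exact: mulrC.
Qed.

Lemma mdotDl M M' N : mdot (M + M') N = mdot M N + mdot M' N.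
Proof.
rewrite /mdot -mulrDr -big_split; congr (_ * _); apply: eq_bigr => i _ /=.
by rewrite -big_split; apply: eq_bigr => j _; rewrite !mxE mulrDl.
Qed.

Lemma mdotZl c M N : mdot (c *: M) N = c * mdot M N.
Proof.
rewrite /mdot mulrCA; congr (_ * _); rewrite mulr_sumr; apply: eq_bigr => i _.
by rewrite mulr_sumr; apply: eq_bigr => j _; rewrite !mxE mulrA.
Qed.

Lemma mdotBl M M' N : mdot (M - M') N = mdot M N - mdot M' N.
Proof. by rewrite mdotDl -scaleN1r mdotZl mulN1r. Qed.

Lemma mdotBr M N N' : mdot M (N - N') = mdot M N - mdot M N'.
Proof. by rewrite !(mdotC M) mdotBl. Qed.

Lemma mdotZr c M N : mdot M (c *: N) = c * mdot M N.
Proof. by rewrite !(mdotC M) mdotZl. Qed.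

Lemma mdot_suml (I : Type) (r : seq I) (P : pred I) (F : I -> 'M[R]_n) N :
  mdot (\sum_(i <- r | P i) F i) N = \sum_(i <- r | P i) mdot (F i) N.
Proof.
apply: (big_morph (mdot^~ N)) => [M M'|]; first exact: mdotDl.
by rewrite -(scale0r 0) mdotZl mul0r.
Qed.

Lemma mdot_ge0 M : 0 <= mdot M M.
Proof.
rewrite mulr_ge0 ?invr_ge0 ?ler0n //.
by apply: sumr_ge0 => i _; apply: sumr_ge0 => j _; rewrite -expr2 sqr_ge0.
Qed.

Lemma mdot_eq0 M : (mdot M M == 0) = (M == 0).
Proof.
apply/eqP/eqP => [|->]; last by rewrite -(scale0r 0) mdotZl mul0r.
move=> /eqP; rewrite mulf_eq0 invr_eq0 pnatr_eq0 => /orP[/eqP n0|].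
  by apply/matrixP => i; have := ltn_ord i; rewrite [X in (_ < X)%N]n0.
have row_ge0 i : 0 <= \sum_j M i j * M i j.
  by apply: sumr_ge0 => j _; rewrite -expr2 sqr_ge0.
rewrite psumr_eq0 // => /allP M0; apply/matrixP => i j.
have /implyP/(_ isT) := M0 i (mem_index_enum i).
rewrite psumr_eq0 => [/allP Mi0|? _]; last by rewrite -expr2 sqr_ge0.
have /implyP/(_ isT) := Mi0 j (mem_index_enum j).
by rewrite mulf_eq0 orbb mxE => /eqP.
Qed.

(** The trace form depends on the values of the polynomials at A only, and becomes
positive definite on them because f(A) is again symmetric. *)
Lemma mxdotE (A : 'M[R]_n) f g :
  A^T = A -> mxdot A f g = mdot (pevalmx f A) (pevalmx g A).
Proof.
move=> symA; congr (_ * _); apply: eq_bigr => i _; rewrite mxE.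
by apply: eq_bigr => j _; rewrite -[in X in _ * X](tr_pevalmx g symA) mxE.
Qed.
End MatrixScalarProduct.

(** * Spectral theory of a symmetric matrix over a real closed field *)

(** Polynomials act on a diagonalizable matrix through their values at its
eigenvalues, and a Hermitian matrix is unitarily diagonalizable with real
eigenvalues. *)
Lemma hermitian_horner_mx0 (C : numClosedFieldType) n (B : 'M[C]_n.+1) q :
    B \is hermsymmx ->
    (forall a, a \is Num.real -> eigenvalue B a -> q.[a] = 0) ->
  horner_mx B q = 0.
Proof.
move=> hermB q0; have /orthomx_spectralP diagB := hermitian_normalmx hermB.
have real_s := hermitian_spectral_diag_real hermB.
have unitP : spectralmx B \is a GRing.unit := spectral_unit B.
rewrite diagB horner_mx_uconjC // horner_mx_diag.
suff ->: map_mx (horner q) (spectral_diag B) = 0.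
  by rewrite linear0 mulmx0 mul0mx.
apply/rowP => i; rewrite !mxE q0 //; first exact/mxOverP.
apply/eigenvalueP; exists (row i (spectralmx B)); last first.
  apply: contraTneq unitP => row0; apply/negP => /mulmxV /(congr1 (row i)).
  rewrite row_mul row0 mul0mx => /rowP/(_ i)/eqP.
  by rewrite !mxE eqxx eq_sym oner_eq0.
rewrite [in X in _ *m X]diagB -row_mul !mulmxA mulmxV // mul1mx row_mul.
by rewrite row_diag_mx -scalemxAl -rowE.
Qed.

(** In a rank factorization E = C *m B of an idempotent, B *m C is the identity
matrix of size the rank, and has the same trace as E. *)
Lemma mxtrace_idem (F : fieldType) n (E : 'M[F]_n) :
  E *m E = E -> \tr E = (\rank E)%:R.
Proof.
move=> idE; rewrite -{1}(mulmx_base E) mxtrace_mulC.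
suff -> : row_base E *m col_base E = 1%:M by rewrite mxtrace1.
apply: (row_free_inj (row_base_free E)); apply: (row_full_inj (col_base_full E)).
by rewrite mul1mx -(mulmxA (row_base E)) [LHS]mulmxA mulmx_base idE.
Qed.

Section SymmetricSpectrum.
Variables (R : rcfType) (n d : nat) (A : 'M[R]_n) (lam : 'I_d.+1 -> R).
Hypotheses (symA : A^T = A) (specA : is_spectrum A lam).
Implicit Types f g : {poly R}.

Lemma lam_inj : injective lam.
Proof.
case: specA => lam_dec _ i j eq_ij; apply/val_inj/eqP.
by case: ltngtP => // /lam_dec; rewrite eq_ij ltxx.
Qed.

Lemma lam_eigenvector i : exists2 v : 'rV[R]_n, v *m A = lam i *: v & v != 0.
Proof. by apply/eigenvalueP/specA.2; exists i. Qed.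

(** A real symmetric matrix is Hermitian over R[i], where the spectral theorem
applies; the eigenvalues met there are real, hence eigenvalues over R. *)
Lemma pevalmx_spec0 f : (forall i, f.[lam i] = 0) -> pevalmx f A = 0.
Proof.
move=> f0; move: symA (specA.2).
case: (n) (A) => [|n'] B; first by move=> _ _; apply/matrixP => -[].
move=> symB eigB; rewrite pevalmxE.
pose BC := map_mx (real_complex R) B.
have hermB : BC \is hermsymmx.
  apply: realsym_hermsym.
    by apply/is_hermitianmxP; rewrite expr0 scale1r map_mx_id // /BC map_trmx symB.
  by apply/mxOverP => i j; rewrite mxE complex_real.
suff: map_mx (real_complex R) (horner_mx B f) = 0.
  by move/eqP; rewrite map_mx_eq0 => /eqP.
rewrite map_horner_mx; apply: hermitian_horner_mx0 => // a real_a.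
rewrite -(RRe_real real_a) eigenvalue_map => /eigB[j ->].
by rewrite horner_map /= f0.
Qed.

(** An eigenvector for lam i turns f(A) into f(lam i); conversely f - g vanishes on
the spectrum. *)
Lemma pevalmx_specE f g :
  pevalmx f A = pevalmx g A <-> (forall i, f.[lam i] = g.[lam i]).
Proof.
split=> [fg i|fg].
  have [v vA v0] := lam_eigenvector i.
  have := pevalmx_eigen f vA; rewrite fg (pevalmx_eigen g vA) => /eqP.
  by rewrite -subr_eq0 -scalerBl scaler_eq0 (negbTE v0) orbF subr_eq0 => /eqP.
apply/eqP; rewrite -subr_eq0 -pevalmxB; apply/eqP/pevalmx_spec0 => i.
by rewrite !hornerE fg subrr.
Qed.

(** The value of this interpolation polynomial at A is the orthogonal projection
onto the eigenspace of lam i. *)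
Definition lagrange i : {poly R} :=
  (phi lam i)^-1 *: \prod_(j < d.+1 | j != i) ('X - (lam j)%:P).

Lemma phi_neq0 i : phi lam i != 0.
Proof.
apply/prodf_neq0 => j ji; rewrite subr_eq0.
by apply: contraNneq ji => /lam_inj ->.
Qed.

Lemma lagrangeE i j : (lagrange i).[lam j] = (i == j)%:R.
Proof.
rewrite hornerZ horner_prod; case: eqVneq => [<-|ij].
  rewrite (eq_bigr (fun l => lam i - lam l)) => [|l _]; last by rewrite !hornerE.
  by rewrite mulVf ?phi_neq0.
by rewrite (bigD1 j) 1?eq_sym //= hornerXsubC subrr mul0r mulr0.
Qed.

Lemma size_prod_others i :
  size (\prod_(j < d.+1 | j != i) ('X - (lam j)%:P)) = d.+1.
Proof.
rewrite -big_filter size_prod_XsubC; congr _.+1.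
suff -> : size [seq j <- index_enum 'I_d.+1 | j != i] = #|predC1 i|.
  by rewrite cardC1 card_ord.
by rewrite cardE /enum_mem size_filter -size_filter.
Qed.

Lemma size_lagrange i : (size (lagrange i) <= d.+1)%N.
Proof.
by apply: leq_trans (size_scale_leq _ _) _; rewrite size_prod_others.
Qed.

(** The powers I, A, ..., A^d are linearly independent: a polynomial of degree at
most d that kills A has the d+1 distinct eigenvalues as roots. *)
Lemma pevalmx_low_eq0 f : (size f <= d.+1)%N -> pevalmx f A = 0 -> f = 0.
Proof.
move=> size_f f0; apply: (@roots_geq_poly_eq0 _ _ [seq lam i | i <- enum 'I_d.+1]).
- apply/allP => _ /mapP[i _ ->]; apply/rootP; rewrite -[RHS](horner0 (lam i)).
  by apply: (pevalmx_specE _ _).1; rewrite f0 pevalmx0.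
- by rewrite map_inj_uniq ?enum_uniq //; apply: lam_inj.
- by rewrite size_map size_enum_ord.
Qed.

Lemma pevalmx_lagrange f :
  pevalmx f A = \sum_i f.[lam i] *: pevalmx (lagrange i) A.
Proof.
under eq_bigr do rewrite -pevalmxZ.
rewrite -pevalmx_sum; apply/pevalmx_specE => j.
rewrite horner_sum (bigD1 j) //= big1 => [|i ij].
  by rewrite hornerZ lagrangeE eqxx mulr1 addr0.
by rewrite hornerZ lagrangeE (negbTE ij) mulr0.
Qed.

Lemma lagrange_idem i :
  pevalmx (lagrange i) A *m pevalmx (lagrange i) A = pevalmx (lagrange i) A.
Proof.
rewrite -pevalmxM; apply/pevalmx_specE => j.
by rewrite hornerM !lagrangeE -natrM mulnb andbb.
Qed.

Lemma lagrange_eigen i :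
  pevalmx (lagrange i) A *m A = lam i *: pevalmx (lagrange i) A.
Proof.
rewrite -{2}(pevalmxX A) -pevalmxM -pevalmxZ; apply/pevalmx_specE => j.
rewrite hornerM [RHS]hornerZ !lagrangeE hornerX.
by case: eqVneq => [->|_]; rewrite ?mul1r ?mulr1 ?mul0r ?mulr0.
Qed.

(** The projection onto an eigenspace has trace equal to its rank; this is where
the multiplicities enter the trace form. *)
Lemma mxtrace_lagrange i : \tr (pevalmx (lagrange i) A) = (mult A (lam i))%:R.
Proof.
rewrite mxtrace_idem ?lagrange_idem //; congr (_%:R).
apply/eqP; rewrite eqn_leq !mxrankS //; last first.
  by apply/eigenspaceP; exact: lagrange_eigen.
have /eigenspaceP/(pevalmx_eigen (lagrange i)) := submx_refl (eigenspace A (lam i)).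
by rewrite lagrangeE eqxx scale1r => {1}<-; exact: submxMl.
Qed.

Lemma mxdot_spec f g : mxdot A f g =
  n%:R^-1 * \sum_i (mult A (lam i))%:R * (f.[lam i] * g.[lam i]).
Proof.
rewrite /mxdot -pevalmxM pevalmx_lagrange linear_sum; congr (_ * _).
apply: eq_bigr => i _ /=.
by rewrite linearZ /= mxtrace_lagrange hornerM mulrC.
Qed.
End SymmetricSpectrum.

(** * Predistance polynomials *)

Lemma size_cancel_lead (F : fieldType) m (f g : {poly F}) :
  (size f <= m.+1)%N -> size g = m.+1 ->
  (size (f - (f`_m / g`_m) *: g)%R <= m)%N.
Proof.
move=> size_f size_g; have gm0 : g`_m != 0.
  by rewrite -[m]/(m.+1.-1) -size_g lead_coef_eq0 -size_poly_eq0 size_g.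
apply/leq_sizeP => j; rewrite leq_eqVlt coefB coefZ => /orP[/eqP <-|ltmj].
  by rewrite divfK ?subrr.
have le_fj := leq_trans size_f ltmj.
have le_gj : (size g <= j)%N by rewrite size_g.
by rewrite (nth_default _ le_fj) (nth_default _ le_gj) mulr0 subrr.
Qed.

Section Predistance.
Variables (R : rcfType) (n d : nat) (A : 'M[R]_n).
Variables (lam : 'I_d.+1 -> R) (p : 'I_d.+1 -> {poly R}).
Hypotheses (symA : A^T = A) (specA : is_spectrum A lam).
Hypothesis predA : predistance A lam p.
Implicit Types f g : {poly R}.

Let k0 := lam ord0.

Lemma mxdotC f g : mxdot A f g = mxdot A g f.
Proof. by rewrite !mxdotE // mdotC. Qed.

Lemma mxdotX f g : mxdot A ('X * f) g = mxdot A f ('X * g).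
Proof.
by rewrite !(mxdot_spec symA specA); congr (_ * _); apply: eq_bigr => i _;
  rewrite !hornerM; ring.
Qed.

(** p_i has degree i, so the first m of them span the polynomials of degree < m. *)
Lemma predistance_combination m f : (size f <= m)%N -> (m <= d.+1)%N ->
  exists2 c : 'I_d.+1 -> R, f = \sum_i c i *: p i &
    forall i : 'I_d.+1, (m <= i)%N -> c i = 0.
Proof.
elim: m f => [|m IH] f size_f lemd.
  exists (fun=> 0) => //; rewrite big1 => [|i _]; last by rewrite scale0r.
  by apply/eqP; rewrite -size_poly_leq0.
have [size_p _ _] := predA; pose j := Ordinal lemd.
have [c] := IH _ (size_cancel_lead size_f (size_p j)) (ltnW lemd).
move: (f`_m / _) => a def_f c0; exists (fun i => c i + a *+ (i == j)) => [|i lt_mi].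
  move/eqP: def_f; rewrite subr_eq => /eqP->.
  under [RHS]eq_bigr do rewrite scalerDl; rewrite big_split; congr (_ + _).
  rewrite (bigD1 j) //= eqxx big1 ?addr0 // => i /negbTE->.
  by rewrite scale0r.
rewrite c0 1?ltnW // add0r; case: eqP lt_mi => // -> /=.
by rewrite ltnn.
Qed.

Lemma mxdot_predistance_low (i : 'I_d.+1) f : (size f <= i)%N -> mxdot A (p i) f = 0.
Proof.
move=> size_f; have [_ orth _] := predA.
have [c -> c0] := predistance_combination size_f (ltnW (ltn_ord i)).
rewrite mxdotC mxdotE // pevalmx_sum mdot_suml big1 // => j _.
rewrite pevalmxZ mdotZl -mxdotE //.
have [/c0->|ltji] := leqP i j; first exact: mul0r.
by rewrite orth ?mulr0 //; apply: contraTneq ltji => ->; rewrite ltnn.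
Qed.

(** p_i(lambda_0) is the squared norm of p_i(A), which is nonzero because p_i has degree
at most d. *)
Lemma predistance_gt0 i : 0 < (p i).[k0].
Proof.
have [size_p _ norm_p] := predA.
rewrite -norm_p mxdotE // lt0r mdot_ge0 andbT mdot_eq0.
apply: contra_eqN (size_p i) => /eqP pi0.
suff -> : p i = 0 by rewrite size_poly0.
by apply: (pevalmx_low_eq0 symA specA) pi0; rewrite size_p.
Qed.

Lemma predistance_neq0 i : (p i).[k0] != 0.
Proof. by rewrite gt_eqF ?predistance_gt0. Qed.

(** Expansion in the orthogonal basis p_0(A), ..., p_d(A). There is no bound on the
degree of f: interpolation on the spectrum brings it down to d. *)
Lemma pevalmx_fourier f :
  pevalmx f A = \sum_i (mxdot A f (p i) / (p i).[k0]) *: pevalmx (p i) A.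
Proof.
have [_ orth norm_p] := predA.
pose g := \sum_i f.[lam i] *: lagrange lam i.
have fg : pevalmx f A = pevalmx g A.
  rewrite (pevalmx_lagrange symA specA) /g pevalmx_sum.
  by apply: eq_bigr => i _; rewrite [RHS]pevalmxZ.
have [|c def_g _] := @predistance_combination d.+1 g _ (leqnn _).
  apply: leq_trans (size_sum _ _ _) _; apply/bigmax_leqP => i _.
  exact: leq_trans (size_scale_leq _ _) (size_lagrange _ _).
rewrite fg {1}def_g pevalmx_sum; apply: eq_bigr => i _.
rewrite pevalmxZ !mxdotE // fg def_g pevalmx_sum mdot_suml (bigD1 i) //= big1.
  rewrite pevalmxZ mdotZl -mxdotE // norm_p addr0 mulfK //.
  exact: predistance_neq0.
by move=> j ji; rewrite pevalmxZ mdotZl -mxdotE // orth ?mulr0.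
Qed.

(** The normalization |p_i|^2 = p_i(lambda_0) makes p_0 + ... + p_d the
representative of evaluation at lambda_0. *)
Lemma mxdot_sum_predistance f : mxdot A (\sum_i p i) f = f.[k0].
Proof.
have /(pevalmx_specE symA specA)/(_ ord0) -> : pevalmx f A =
    pevalmx (\sum_i (mxdot A f (p i) / (p i).[k0]) *: p i) A.
  by rewrite {1}pevalmx_fourier pevalmx_sum; under [RHS]eq_bigr do rewrite pevalmxZ.
rewrite mxdotE // pevalmx_sum mdot_suml horner_sum; apply: eq_bigr => i _.
by rewrite hornerZ divfK ?predistance_neq0 // -mxdotE // mxdotC.
Qed.

(** The three-term recurrence, in the form needed to descend from p_{i+1}, p_{i+2},
... to p_i: multiplication by X is self-adjoint, so X p_{i+1} is orthogonal to
all p_l with l < i, and its component along p_i does not vanish because X p_i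
has degree i+1. *)
Lemma predistance_recurrence (i j : 'I_d.+1) : val j = i.+1 ->
  exists b c, b != 0 /\ A *m pevalmx (p j) A =
    b *: pevalmx (p i) A + \sum_(l < d.+1 | (i < l)%N) c l *: pevalmx (p l) A.
Proof.
move=> ji; have [size_p _ norm_p] := predA.
pose c l := mxdot A ('X * p j) (p l) / (p l).[k0].
have lead0 l : (p l)`_l != 0.
  by rewrite -[X in _`_X]/(l.+1.-1) -(size_p l) lead_coef_eq0 -size_poly_eq0 size_p.
have size_Xp l : size ('X * p l) = l.+2.
  by rewrite mulrC size_mulX ?size_p // -size_poly_eq0 size_p.
exists (c i), c; split.
  rewrite mulf_neq0 ?invr_eq0 ?predistance_neq0 // mxdotX.
  have le_size : (size ('X * p i)%R <= j.+1)%N by rewrite size_Xp ji.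
  have := mxdot_predistance_low (size_cancel_lead le_size (size_p j)).
  rewrite mxdotE // pevalmxB pevalmxZ mdotBr mdotZr -!mxdotE // norm_p => /eqP.
  rewrite subr_eq0 => /eqP->; rewrite mulf_neq0 ?predistance_neq0 //.
  by rewrite mulf_neq0 ?invr_eq0 ?lead0 // coefXM ji /= lead0.
rewrite -{1}(pevalmxX A) -pevalmxM pevalmx_fourier.
rewrite (bigID (fun l : 'I_d.+1 => (i < l)%N)) addrC; congr (_ + _).
rewrite (bigD1 i) ?ltnn //= big1 ?addr0 // => l /andP[].
rewrite -leqNgt leq_eqVlt => /predU1P[/val_inj->|lt_li _]; first by rewrite eqxx.
by rewrite mxdotX mxdot_predistance_low ?mul0r ?scale0r // size_Xp ji !ltnS.
Qed.

Hypotheses (n_gt0 : (0 < n)%N) (mult0 : mult A k0 = 1%N).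

(** When the largest eigenvalue is simple, n times the projection onto its
eigenspace also represents evaluation at that eigenvalue. *)
Lemma sum_predistance :
  pevalmx (\sum_i p i) A = n%:R *: pevalmx (lagrange lam ord0) A.
Proof.
apply/eqP; rewrite -subr_eq0 -mdot_eq0 -pevalmxZ -pevalmxB; set f := _ - _.
rewrite {1}pevalmxB mdotBl -!mxdotE // mxdot_sum_predistance.
rewrite [X in _ - X](mxdot_spec symA specA) (bigD1 ord0) //= big1 => [|i i0].
  rewrite hornerZ (lagrangeE specA) eqxx mulr1 addr0 mult0 mul1r mulKf ?subrr //.
  by rewrite pnatr_eq0 -lt0n.
by rewrite hornerZ (lagrangeE specA) eq_sym (negbTE i0) mulr0 mul0r mulr0.
Qed.

Lemma horner_sum_predistance : \sum_i (p i).[k0] = n%:R.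
Proof.
have := sum_predistance; rewrite -pevalmxZ.
move/(pevalmx_specE symA specA)/(_ ord0); rewrite horner_sum => ->.
by rewrite hornerZ (lagrangeE specA) eqxx mulr1.
Qed.

Lemma mult_neq0 i : mult A (lam i) != 0%N.
Proof. by rewrite mxrank_eq0; apply/specA.2; exists i. Qed.

(** Distinct products prod_(l != i) (X - lambda_l) are monic of degree d, so their
difference is orthogonal to p_d; on the spectrum such a product is nonzero only
at lambda_i, with value phi_i. *)
Lemma predistance_last_horner i :
  (mult A (lam i))%:R * phi lam i * (p ord_max).[lam i] =
  phi lam ord0 * (p ord_max).[k0].
Proof.
pose L j : {poly R} := \prod_(l < d.+1 | l != j) ('X - (lam l)%:P).
have LE j : L j = phi lam j *: lagrange lam j.
  by rewrite scalerA mulfV ?scale1r // (phi_neq0 specA).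
have size_L j : size (L j) = d.+1 := size_prod_others lam j.
have monic_L j : (L j)`_d = 1.
  by have /monicP := monic_prod_XsubC (index_enum 'I_d.+1) (fun l => l != j) lam;
    rewrite lead_coefE -/(L j) size_L.
have : mxdot A (p ord_max) (L i - L ord0) = 0.
  apply: mxdot_predistance_low.
  have := size_cancel_lead (eq_leq (size_L i)) (size_L ord0).
  by rewrite !monic_L divr1 scale1r.
have dotL j : mxdot A (p ord_max) (L j) =
    n%:R^-1 * ((mult A (lam j))%:R * phi lam j * (p ord_max).[lam j]).
  rewrite (mxdot_spec symA specA) (bigD1 j) //= big1 => [|l lj].
    by rewrite LE hornerZ (lagrangeE specA) eqxx mulr1; congr (_ * _); ring.
  by rewrite LE hornerZ (lagrangeE specA) eq_sym (negbTE lj) !mulr0.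
rewrite mxdotE // pevalmxB mdotBr -!mxdotE // !dotL -mulrBr => /eqP.
rewrite mulf_eq0 invr_eq0 pnatr_eq0 -[n == 0%N]negbK -lt0n n_gt0 /=.
by rewrite mult0 mul1r subr_eq0 => /eqP.
Qed.

(** The previous lemma expresses all the values of p_d on the spectrum by
P = p_d(lambda_0); substituting them in |p_d|^2 = P gives n P = P^2 S, where S is
the sum below, and P is nonzero. *)
Lemma predistance_last_spec : n%:R - (p ord_max).[k0] =
  n%:R * (1 - (\sum_(i < d.+1)
     (phi lam ord0) ^+ 2 / ((mult A (lam i))%:R * (phi lam i) ^+ 2))^-1).
Proof.
set S := \sum_(i < _) _; have [_ _ norm_p] := predA.
have n0 : n%:R != 0 :> R by rewrite pnatr_eq0 -lt0n.
have P0 : (p ord_max).[k0] != 0 := predistance_neq0 _.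
have : (p ord_max).[k0] = n%:R^-1 * ((p ord_max).[k0] ^+ 2 * S).
  rewrite -{1}norm_p (mxdot_spec symA specA); congr (_ * _).
  rewrite [RHS]mulr_sumr.
  apply: eq_bigr => i _.
  have m0 : (mult A (lam i))%:R != 0 :> R by rewrite pnatr_eq0 mult_neq0.
  have f0 := phi_neq0 specA i.
  have -> : (p ord_max).[lam i] =
      phi lam ord0 * (p ord_max).[k0] / ((mult A (lam i))%:R * phi lam i).
    by rewrite -(predistance_last_horner i); field; rewrite ?m0 ?f0.
  by field; rewrite ?m0 ?f0.
move=> eqP1; have S0 : S != 0.
  by apply: contra_eqN eqP1 => /eqP->; rewrite mulr0 mulr0.
suff : (p ord_max).[k0] = n%:R / S by rewrite mulrBr mulr1 => ->.
apply: (mulIf P0); apply: (mulIf S0).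
have nP : n%:R * (p ord_max).[k0] = (p ord_max).[k0] ^+ 2 * S.
  by rewrite {1}eqP1 mulVKf.
by rewrite -expr2 -nP; field.
Qed.
End Predistance.

(** * Distances in a connected graph *)

Section Distance.
Variables (X : finType) (e : rel X).
Hypotheses (sym_e : symmetric e) (irr_e : irreflexive e).
Hypothesis conn_e : forall x y, connect e x y.
Implicit Types (x y z : X) (l : nat).

Lemma has_walkP x y l :
  reflect (exists w, [/\ size w = l, path e x w & last x w = y]) (has_walk e x y l).
Proof.
apply: (iffP existsP) => [[w /andP[e_w /eqP]]|[w [size_w e_w last_w]]].
  by exists w; rewrite size_tuple.
by exists (tcast size_w (in_tuple w)); rewrite val_tcast e_w last_w eqxx.
Qed.

Lemma has_walkS x y z l : e x z -> has_walk e z y l -> has_walk e x y l.+1.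
Proof.
move=> e_xz /has_walkP[w [<- e_w <-]].
by apply/has_walkP; exists (z :: w); rewrite /= e_xz.
Qed.

Lemma gdist_le x y l : has_walk e x y l -> (gdist e x y <= l)%N.
Proof.
move=> walk_l; rewrite leqNgt; apply/negP => lt_l.
have lt_X : (l < #|X|)%N.
  by apply: leq_trans lt_l _; rewrite -[X in (_ <= X)%N](size_iota 0) find_size.
by have := before_find 0%N lt_l; rewrite nth_iota // add0n walk_l.
Qed.

Lemma gdist_walk x y : has_walk e x y (gdist e x y).
Proof.
have /connectP[w0 e_w0 ->] := conn_e x y.
case/shortenP: e_w0 => w e_w uniq_w _.
have walk_w : has_walk e x (last x w) (size w) by apply/has_walkP; exists w.
have lt_w : (size w < #|X|)%N 
  by rewrite -[(size w).+1]/(size (x :: w)) -(card_uniqP uniq_w) max_card.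
have has_w : has (has_walk e x (last x w)) (iota 0 #|X|).
  by apply/hasP; exists (size w); rewrite ?mem_iota.
have := nth_find 0%N has_w; rewrite nth_iota ?add0n //.
by rewrite -[X in (_ < X)%N](size_iota 0) -has_find.
Qed.

Lemma gdist_eq0 x y : (gdist e x y == 0%N) = (x == y).
Proof.
apply/eqP/eqP => [dxy|->].
  by have := gdist_walk x y; rewrite dxy => /has_walkP[[|a w] []].
by apply/eqP; rewrite -leqn0; apply: gdist_le; apply/has_walkP; exists [::].
Qed.

Lemma gdist_step x y z : e x z -> (gdist e x y <= (gdist e z y).+1)%N.
Proof. by move=> e_xz; apply/gdist_le/(has_walkS e_xz)/gdist_walk. Qed.

Lemma gdistC x y : gdist e x y = gdist e y x.
Proof.
suff le_sym u v : (gdist e u v <= gdist e v u)%N.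
  by apply/eqP; rewrite eqn_leq !le_sym.
apply: gdist_le; have /has_walkP[w [<- e_w <-]] := gdist_walk v u.
apply/has_walkP; exists (rev (belast v w)); rewrite size_rev size_belast; split=> //.
  by rewrite rev_path (eq_path (e' := e)) // => a b; rewrite sym_e.
by case: (w) => //= a w'; rewrite rev_cons last_rcons.
Qed.

Lemma gdist_eq1 x y : (gdist e x y == 1%N) = e x y.
Proof.
apply/eqP/idP => [dxy|e_xy].
  have := gdist_walk x y; rewrite dxy => /has_walkP[[|z [|a w]] []] //= _.
  by rewrite andbT => e_xz <-.
apply/eqP; rewrite eqn_leq lt0n gdist_eq0; apply/andP; split.
  by apply/gdist_le/has_walkP; exists [:: y]; rewrite /= e_xy.
by apply: contraTneq e_xy => ->; rewrite irr_e.
Qed.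

Lemma gdist_diam x y : (gdist e x y <= diam e)%N.
Proof. by apply: leq_trans (leq_bigmax _); apply: (leq_bigmax (F := gdist e x)). Qed.

Lemma diam_attained : (0 < #|X|)%N -> exists x y, gdist e x y = diam e.
Proof.
move=> X_gt0.
have [x diam_x] := @bigop.eq_bigmax X (fun x => \max_y gdist e x y)%N X_gt0.
have [y diam_y] := @bigop.eq_bigmax X (gdist e x) X_gt0.
by exists x, y; rewrite -diam_y -diam_x.
Qed.
End Distance.

(** * Adjacency and distance matrices of a regular graph *)

Section GraphMatrices.
Variables (R : rcfType) (X : finType) (e : rel X) (k : nat).
Hypotheses (sym_e : symmetric e) (irr_e : irreflexive e).
Hypothesis conn_e : forall x y, connect e x y.
Hypothesis reg_e : forall x, #|[set y | e x y]| = k.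

Local Notation A := (adjmx e R).
Local Notation dist i j := (gdist e (enum_val i) (enum_val j)).

Lemma sum_enum_val (F : X -> R) : \sum_(i < #|X|) F (enum_val i) = \sum_x F x.
Proof. by rewrite -big_enum_val; apply: eq_bigl. Qed.

Lemma tr_adjmx : A^T = A.
Proof. by apply/matrixP => i j; rewrite !mxE sym_e. Qed.

Lemma distmx1 : distmx e R 1 = A.
Proof. by apply/matrixP => i j; rewrite !mxE gdist_eq1. Qed.

Lemma distmx_mul i j (u v : 'I_#|X|) : (distmx e R i *m distmx e R j) u v =
  #|sphere e i (enum_val u) :&: sphere e j (enum_val v)|%:R.
Proof.
rewrite mxE; under eq_bigr do rewrite !mxE.
rewrite (sum_enum_val (fun z => (gdist e (enum_val u) z == i)%:R *
   (gdist e z (enum_val v) == j)%:R)).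
rewrite -sum1_card natr_sum [RHS]big_mkcond; apply: eq_bigr => z _.
rewrite !inE (gdistC sym_e conn_e z).
by case: eqP => _; case: eqP => _; rewrite ?mulr0 ?mul0r ?mulr1.
Qed.

Lemma distmx_row_sum h i :
  \sum_j distmx e R h i j = #|sphere e h (enum_val i)|%:R.
Proof.
under eq_bigr do rewrite mxE.
rewrite (sum_enum_val (fun z => (gdist e (enum_val i) z == h)%:R)).
rewrite -sum1_card natr_sum [RHS]big_mkcond; apply: eq_bigr => z _.
by rewrite inE; case: eqP.
Qed.

Lemma adjmx_exp_walk l i j :
  (A ^+ l) i j != 0 -> has_walk e (enum_val i) (enum_val j) l.
Proof.
elim: l i => [|l IH] i.
  rewrite expr0 mxE pnatr_eq0 eqb0 negbK => /eqP->.
  by apply/has_walkP; exists [::].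
rewrite exprS [X in X != 0]mxE; apply: contraNT => no_walk.
rewrite big1 // => m _; rewrite mxE; case e_im: (e _ _); last exact: mul0r.
rewrite mul1r; apply/eqP; apply: contraNT no_walk => /IH.
exact: has_walkS.
Qed.

Lemma pevalmx_far0 (f : {poly R}) (i j : 'I_#|X|) :
  (size f <= dist i j)%N -> pevalmx f A i j = 0.
Proof.
move=> far; rewrite summxE big1 // => l _; rewrite mxE.
apply/eqP; rewrite mulf_eq0; apply/orP; right.
apply: contraLR far => /adjmx_exp_walk/gdist_le le_l.
by rewrite -ltnNge (leq_ltn_trans le_l).
Qed.

Lemma const_mulmx_adjmx : const_mx 1 *m A = k%:R *: const_mx 1 :> 'rV[R]_#|X|.
Proof.
apply/rowP => j; rewrite !mxE mulr1.
under eq_bigr do rewrite !mxE mul1r sym_e.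
rewrite (sum_enum_val (fun z => (e (enum_val j) z)%:R)) -(reg_e (enum_val j)).
rewrite -sum1_card natr_sum [RHS]big_mkcond; apply: eq_bigr => z _.
by rewrite inE; case: (e _ _).
Qed.

Lemma pevalmx_row_sum f i : \sum_j pevalmx f A i j = f.[k%:R].
Proof.
have := pevalmx_eigen f const_mulmx_adjmx; move/rowP/(_ i).
rewrite !mxE mulr1 => <-; apply: eq_bigr => j _.
by rewrite mxE mul1r -[in RHS](tr_pevalmx f tr_adjmx) mxE.
Qed.

(** Maximum principle: at a vertex where v is maximal, k times that maximum is the
sum of v over the k neighbours, so v is maximal there too, and connectedness
propagates this to all vertices. *)
Lemma eigenvector_constant (v : 'rV[R]_#|X|) :
  v *m A = k%:R *: v -> forall i j, v 0 i = v 0 j.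
Proof.
move=> vA i0 j0; pose i := [arg max_(i > i0) v 0 i]%O.
have max_i j : v 0 j <= v 0 i by rewrite /i; case: arg_maxP => // l _; apply.
pose a z := v 0 (enum_rank z).
have step x y : a x = v 0 i -> e x y -> a y = v 0 i.
  move=> ax e_xy; have : \sum_z (e x z)%:R * (v 0 i - a z) = 0.
    under eq_bigr do rewrite mulrBr; rewrite sumrB -mulr_suml.
    have /rowP/(_ (enum_rank x)) := vA; rewrite !mxE -/(a x) ax.
    rewrite -{1}(reg_e x) -sum1_card natr_sum [in RHS]big_mkcond /= => vAx.
    apply/eqP; rewrite subr_eq0; apply/eqP; transitivity
      (\sum_j v 0 j * A j (enum_rank x)).
      rewrite vAx; congr (_ * _); apply: eq_bigr => z _.
      by rewrite inE; case: (e _ _).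
    rewrite -sum_enum_val; apply: eq_bigr => j _.
    by rewrite mxE enum_rankK sym_e /a enum_valK mulrC.
  move/eqP; rewrite psumr_eq0 => [/allP/(_ y (mem_index_enum y))|z _].
    by rewrite /= e_xy mul1r subr_eq0 => /eqP.
  by rewrite mulr_ge0 ?ler0n // subr_ge0 max_i.
have const_v j : v 0 j = v 0 i.
  have /connectP[w e_w last_w] := conn_e (enum_val i) (enum_val j).
  have : a (enum_val i) = v 0 i by rewrite /a enum_valK.
  rewrite -[j]enum_valK -/(a _) last_w {last_w}.
  elim: w (enum_val i) e_w => //= y w IH x /andP[e_xy e_w] ax.
  exact: IH e_w (step _ _ ax e_xy).
by rewrite !const_v.
Qed.

Variables (d : nat) (lam : 'I_d.+1 -> R).
Hypotheses (X_gt0 : (0 < #|X|)%N) (specA : is_spectrum A lam).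
Hypothesis lam0 : lam ord0 = k%:R.

Let n_neq0 : #|X|%:R != 0 :> R := lt0r_neq0 (etrans (ltr0n R _) X_gt0).

(** Hoffman's theorem: the rows of the projection are eigenvectors for k, hence
constant, and its row sums are 1. *)
Lemma lagrange0_const : pevalmx (lagrange lam ord0) A = const_mx #|X|%:R^-1.
Proof.
have symA := tr_adjmx; set E := pevalmx _ _.
have row_const i j j' : E i j = E i j'.
  have vA : row i E *m A = k%:R *: row i E.
    by rewrite -row_mul (lagrange_eigen symA specA) lam0 linearZ.
  by have := eigenvector_constant vA j j'; rewrite !mxE.
have symE : E^T = E by apply: tr_pevalmx.
apply/matrixP => i j; rewrite [RHS]mxE; apply: (mulfI n_neq0).
rewrite mulfV // -[RHS](_ : (lagrange lam ord0).[k%:R] = 1); last first.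
  by rewrite -lam0 (lagrangeE specA) eqxx.
rewrite -(pevalmx_row_sum _ i) -/E (eq_bigr (fun=> E i j)) => [|l _].
  by rewrite sumr_const card_ord mulr_natl.
exact: row_const.
Qed.

Lemma mult_lam0 : mult A (lam ord0) = 1%N.
Proof.
apply/eqP; rewrite -(eqr_nat R) -(mxtrace_lagrange tr_adjmx specA) lagrange0_const.
apply/eqP; rewrite /mxtrace; under eq_bigr do rewrite mxE.
by rewrite sumr_const card_ord -[LHS]mulr_natl mulfV.
Qed.
End GraphMatrices.

(** * Comparison of distance matrices with predistance polynomials *)

Section SpectralExcess.
Variables (R : rcfType) (X : finType) (e : rel X) (k d : nat).
Variables (lam : 'I_d.+1 -> R) (p : 'I_d.+1 -> {poly R}).
Hypothesis X_ge2 : (2 <= #|X|)%N.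
Hypotheses (sym_e : symmetric e) (irr_e : irreflexive e).
Hypothesis conn_e : forall x y, connect e x y.
Hypothesis reg_e : forall x, #|[set y | e x y]| = k.

Local Notation A := (adjmx e R).
Local Notation Dm h := (distmx e R h).
Local Notation D := (diam e).
Local Notation n := (#|X|%:R : R).
Local Notation dist i j := (gdist e (enum_val i) (enum_val j)).
Local Notation far x := (#|sphere e D x|%:R : R).

Hypotheses (specA : is_spectrum A lam) (lam0 : lam ord0 = k%:R).
Hypothesis predA : predistance A lam p.

Let X_gt0 : (0 < #|X|)%N := ltnW X_ge2.
Let symA : A^T = A := tr_adjmx R sym_e.
Let n_gt0 : 0 < n := etrans (ltr0n R _) X_gt0.
Let mult0 := mult_lam0 sym_e conn_e reg_e X_gt0 specA lam0.
Let size_p i : size (p i) = i.+1 := let: And3 sz _ _ := predA in sz i.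

Lemma sum_predistance_const : \sum_i pevalmx (p i) A = const_mx 1.
Proof.
rewrite -pevalmx_sum (sum_predistance symA specA predA X_gt0 mult0).
rewrite (lagrange0_const sym_e conn_e reg_e X_gt0 specA lam0).
by apply/matrixP => i j; rewrite !mxE mulfV ?gt_eqF.
Qed.

Lemma mdot_distmx_const h :
  mdot (Dm h) (const_mx 1) = n^-1 * \sum_x #|sphere e h x|%:R.
Proof.
congr (_ * _); rewrite -[RHS]sum_enum_val; apply: eq_bigr => i _.
by rewrite -distmx_row_sum; apply: eq_bigr => j _; rewrite [X in _ * X]mxE mulr1.
Qed.

Lemma mdot_distmx h : mdot (Dm h) (Dm h) = n^-1 * \sum_x #|sphere e h x|%:R.
Proof.
rewrite -mdot_distmx_const; congr (_ * _); apply: eq_bigr => i _.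
by apply: eq_bigr => j _; rewrite !mxE -natrM mulnb andbb mulr1.
Qed.

Lemma mdot_distmx_low (f : {poly R}) h :
  (size f <= h)%N -> mdot (Dm h) (pevalmx f A) = 0.
Proof.
move=> size_f; rewrite /mdot big1 ?mulr0 // => i _; rewrite big1 // => j _.
rewrite mxE; case: eqP => [dist_ij|_]; last exact: mul0r.
by rewrite mul1r pevalmx_far0 ?dist_ij.
Qed.

(** The polynomials p_i(A) with i < D vanish on the support of A_D, so against A_D
the sum over i >= D is as good as the all-ones matrix. *)
Lemma mdot_distmx_excess :
  mdot (Dm D) (\sum_(i < d.+1 | (D <= i)%N) pevalmx (p i) A) =
  n^-1 * \sum_x far x.
Proof.
rewrite -mdot_distmx_const -sum_predistance_const !(mdotC (Dm D)).
rewrite [in RHS](bigID (fun i : 'I_d.+1 => (D <= i)%N)) /= mdotDl.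
rewrite [X in _ + X]mdot_suml [X in _ + X]big1 ?addr0 // => i.
by rewrite -ltnNge => lt_iD; rewrite mdotC mdot_distmx_low ?size_p.
Qed.

(** Both <A_D, A_D> and <A_D, S> are the average of |Gamma_D(x)|, and <S, S> is the
sum of the p_i(k), by orthogonality and normalization. *)
Lemma excess_gap :
  mdot (Dm D - \sum_(i < d.+1 | (D <= i)%N) pevalmx (p i) A)
       (Dm D - \sum_(i < d.+1 | (D <= i)%N) pevalmx (p i) A) =
  \sum_(i < d.+1 | (D <= i)%N) (p i).[k%:R] - n^-1 * \sum_x far x.
Proof.
set S := \sum_(i < _ | _) pevalmx _ _; have [_ orth norm_p] := predA.
have SS : mdot S S = \sum_(i < d.+1 | (D <= i)%N) (p i).[k%:R].
  rewrite {1}/S mdot_suml; apply: eq_bigr => i Di.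
  rewrite mdotC mdot_suml (bigD1 i) //= big1 => [|j /andP[_ ji]].
    by rewrite addr0 -mxdotE // norm_p lam0.
  by rewrite -mxdotE // orth.
rewrite mdotBl !mdotBr (mdotC S) SS mdot_distmx_excess mdot_distmx; ring.
Qed.

Lemma excess_le :
  n^-1 * \sum_x far x <= \sum_(i < d.+1 | (D <= i)%N) (p i).[k%:R].
Proof. by rewrite -subr_ge0 -excess_gap mdot_ge0. Qed.

Lemma excess_eq :
  n^-1 * \sum_x far x = \sum_(i < d.+1 | (D <= i)%N) (p i).[k%:R] <->
  Dm D = \sum_(i < d.+1 | (D <= i)%N) pevalmx (p i) A.
Proof.
split=> [eq_nf|eq_D]; apply/eqP; rewrite -subr_eq0.
  by rewrite -mdot_eq0 excess_gap eq_nf subrr.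
by rewrite -oppr_eq0 opprB -excess_gap mdot_eq0 eq_D subrr.
Qed.

Lemma average_near : n^-1 * \sum_x (n - far x) = n - n^-1 * \sum_x far x.
Proof.
rewrite sumrB sumr_const -[X in X - _]mulr_natl mulrBr mulKf //.
by rewrite gt_eqF.
Qed.

Lemma average_far_gt0 : 0 < n^-1 * \sum_x far x.
Proof.
have [x [y dist_xy]] := diam_attained e X_gt0.
rewrite mulr_gt0 ?invr_gt0 // (bigD1 x) //= ltr_pwDl ?sumr_ge0 // ltr0n card_gt0.
by apply/set0Pn; exists y; rewrite inE dist_xy.
Qed.

(** If D exceeded d, the right-hand side of [excess_le] would be an empty sum. *)
Lemma diam_le_d : (D <= d)%N.
Proof.
rewrite leqNgt; apply/negP => lt_dD.
have := lt_le_trans average_far_gt0 excess_le.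
rewrite big_pred0 ?ltxx // => i; apply/negbTE.
by rewrite -ltnNge (leq_trans (ltn_ord i)).
Qed.

Lemma sphere_far0 i x : (d < i)%N -> sphere e i x = set0.
Proof.
move=> lt_di; apply/setP => y; rewrite !inE; apply/negbTE; rewrite neq_ltn.
by rewrite (leq_ltn_trans (gdist_diam e x y)) ?(leq_ltn_trans diam_le_d).
Qed.

Lemma diam_gt0 : (0 < D)%N.
Proof.
have /card_gt1P[x [y [_ _ xy]]] := X_ge2.
by apply: leq_trans (gdist_diam e x y); rewrite lt0n gdist_eq0.
Qed.

Local Notation spA := <<[seq A ^+ i | i <- iota 0 d.+1]>>%VS.

Lemma mem_adjacency_algebra M :
  M \in spA <-> exists f, M = pevalmx f A.
Proof.
split=> [|[f ->]].
  move/(@coord_span _ _ _ (in_tuple [seq A ^+ i | i <- iota 0 d.+1])) => ->.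
  set s := in_tuple _; exists (\sum_i coord s i M *: 'X^i).
  rewrite pevalmx_sum; apply: eq_bigr => i _; rewrite pevalmxZ pevalmxXn.
  have lt_id : (i < d.+1)%N.
    by apply: leq_trans (ltn_ord i) _; rewrite size_map size_iota.
  by rewrite (nth_map 0%N) ?size_iota // nth_iota.
rewrite (pevalmx_lagrange symA specA); apply: memv_suml => j _; apply: memvZ.
apply: memv_suml => i _; apply/memvZ/memv_span/mapP; exists (val i) => //.
by rewrite mem_iota /= add0n (leq_trans (ltn_ord i) (size_lagrange _ _)).
Qed.

(** A polynomial in A has constant row sums, so all |Gamma_D(x)| equal their
average. *)
Lemma excess_pointwise x : Dm D \in spA ->
  far x <= \sum_(i < d.+1 | (D <= i)%N) (p i).[k%:R].
Proof.
move=> /mem_adjacency_algebra[f Df].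
have far_f y : far y = f.[k%:R].
  rewrite -(pevalmx_row_sum sym_e reg_e f (enum_rank y)) -Df distmx_row_sum.
  by rewrite enum_rankK.
have := excess_le; rewrite (eq_bigr (fun=> far x)) => [|y _]; last first.
  by rewrite !far_f.
by rewrite sumr_const -[X in _ * X]mulr_natl mulKf // gt_eqF.
Qed.

(** * Characterizations of distance-regularity *)

Lemma distmx_far0 h i j : dist i j != h -> Dm h i j = 0.
Proof. by rewrite mxE => /negbTE->. Qed.

(** Downward induction. Suppose p_l(A) = A_l for all l > i. At distance > i the
matrix p_i(A) vanishes because p_i has degree i. At distance < i the recurrence
expresses it by A A_{i+1} and the A_l with l > i, which all vanish there. At
distance i it is the only nonzero term of sum_l p_l(A) = J. *)
Lemma predistance_distmx : D = d -> Dm D = pevalmx (p ord_max) A ->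
  forall i, pevalmx (p i) A = Dm i.
Proof.
move=> Dd D_pd.
suff IH m : forall i : 'I_d.+1, (d <= i + m)%N -> pevalmx (p i) A = Dm i.
  by move=> i; apply: (IH d); rewrite leq_addl.
elim: m => [|m IH] i; rewrite ?addn0 ?addnS => le_d.
  suff -> : i = ord_max by rewrite -D_pd Dd.
  by apply/val_inj/eqP; rewrite eqn_leq le_d -ltnS ltn_ord.
have [lt_id|le_di] := ltnP i d; last first.
  by apply: IH; apply: leq_trans le_di (leq_addr _ _).
pose j := Ordinal (lt_id : (i.+1 < d.+1)%N).
have Dm_gt (l : 'I_d.+1) : (i < l)%N -> pevalmx (p l) A = Dm l.
  by move=> lt_il; apply: IH; apply: leq_trans le_d _; rewrite -addSn leq_add2r.
have [b [c [b0 rec]]] :=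
  @predistance_recurrence _ _ _ _ _ _ symA specA predA i j erefl.
rewrite (Dm_gt j) // in rec.
apply/matrixP => u v; rewrite mxE.
have [lt_dist|gt_dist|eq_dist] := ltngtP (dist u v) i.
- have /matrixP/(_ u v) := rec; rewrite [LHS]mxE big1 => [|w _]; last first.
    rewrite mxE; case e_uw: (e _ _); last exact: mul0r.
    rewrite mul1r distmx_far0 // neq_ltn; apply/orP; left.
    rewrite sym_e in e_uw.
    by apply: leq_ltn_trans (gdist_step conn_e (enum_val v) e_uw) _.
  rewrite mxE summxE big1 => [|l lt_il]; last first.
    by rewrite mxE Dm_gt // distmx_far0 ?mulr0 // neq_ltn (ltn_trans lt_dist).
  by rewrite addr0 mxE => /esym/eqP; rewrite mulf_eq0 (negbTE b0) => /eqP.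
- by rewrite pevalmx_far0 // size_p.
- have /matrixP/(_ u v) := sum_predistance_const.
  rewrite summxE mxE (bigD1 i) //= big1 ?addr0 // => l l_i.
  have [lt_il|lt_li|/val_inj eq_il] := ltngtP i l.
  + by rewrite Dm_gt // distmx_far0 // eq_dist neq_ltn lt_il.
  + by rewrite pevalmx_far0 // size_p eq_dist.
  + by rewrite eq_il eqxx in l_i.
Qed.

(** The product A_i A_j is a polynomial in A, hence a combination of the matrices
p_l(A) = A_l: its entries, the intersection numbers, depend on the distance
only. *)
Lemma distance_regular_of_polynomials :
  (forall i, pevalmx (p i) A = Dm i) -> distance_regular e.
Proof.
move=> pA; split=> //.
suff inter h i j x y x' y' : gdist e x y = h -> gdist e x' y' = h ->
    #|sphere e i x :&: sphere e j y| = #|sphere e i x' :&: sphere e j y'|.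
  (* Distances that do not occur get the default value 0. *)
  exists (fun h i j => if [pick z : X * X | gdist e z.1 z.2 == h] is Some z
    then #|sphere e i z.1 :&: sphere e j z.2| else 0%N) => h i j x y dxy.
  case: pickP => [[x' y'] /= /eqP dxy'|/(_ (x, y))]; first exact: inter dxy dxy'.
  by rewrite dxy eqxx.
move=> dxy dxy'.
have [i_gt|le_id] := ltnP d i; first by rewrite !(sphere_far0 _ i_gt) !set0I.
have [j_gt|le_jd] := ltnP d j; first by rewrite !(sphere_far0 _ j_gt) !setI0.
pose i' : 'I_d.+1 := Ordinal (le_id : (i < d.+1)%N).
pose j' : 'I_d.+1 := Ordinal (le_jd : (j < d.+1)%N).
have entry u v : gdist e u v = h -> #|sphere e i u :&: sphere e j v|%:R =
    \sum_(l < d.+1) mxdot A (p i' * p j') (p l) / (p l).[k%:R] * (h == l)%:R :> R.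
  move=> duv.
  rewrite -[u]enum_rankK -[v]enum_rankK -(distmx_mul R sym_e conn_e).
  rewrite -[Dm i](pA i') -[Dm j](pA j') -pevalmxM.
  rewrite (pevalmx_fourier symA specA predA) summxE lam0; apply: eq_bigr => l _.
  by rewrite mxE pA mxE !enum_rankK duv.
by apply/eqP; rewrite -(eqr_nat R) !entry.
Qed.

(** The span of A_0, ..., A_D contains I and is stable under multiplication by A,
so it contains the d+1 independent powers of A; since D <= d, the two spans
have the same dimension and coincide. *)
Lemma diam_distance_regular : distance_regular e -> D = d /\ Dm D \in spA.
Proof.
case=> _ [c inter]; pose V := <<[seq Dm h | h <- iota 0 D.+1]>>%VS.
have Dm_V h : (h <= D)%N -> Dm h \in V.
  by move=> le_hD; apply/memv_span/map_f; rewrite mem_iota.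
have AD_V h : A *m Dm h \in V.
  suff -> : A *m Dm h = \sum_(l < D.+1) (c l 1%N h)%:R *: Dm l.
    by apply: memv_suml => l _; apply/memvZ/Dm_V; rewrite -ltnS.
  apply/matrixP => u v; rewrite -(distmx1 R irr_e conn_e) distmx_mul // summxE.
  rewrite (inter _ _ _ _ _ erefl).
  have dist_lt : (dist u v < D.+1)%N by rewrite ltnS gdist_diam.
  rewrite (bigD1 (Ordinal dist_lt)) //= big1 => [|l l_dist].
    by rewrite !mxE eqxx mulr1 addr0.
  by rewrite mxE distmx_far0 ?mulr0 // eq_sym.
have AV M : M \in V -> A *m M \in V.
  move/(@coord_span _ _ _ (in_tuple [seq Dm h | h <- iota 0 D.+1])) => ->.
  rewrite mulmx_sumr; apply: memv_suml => i _.
  rewrite -scalemxAr; apply: memvZ; rewrite (nth_map 0%N) ?AD_V //.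
  by apply: leq_trans (ltn_ord i) _; rewrite size_map.
have pow_V l : A ^+ l \in V.
  elim: l => [|l IH]; last by rewrite exprS AV.
  suff -> : A ^+ 0 = Dm 0 by apply: Dm_V.
  by apply/matrixP => u v; rewrite !mxE gdist_eq0 // (inj_eq enum_val_inj).
have sub_V : (spA <= V)%VS by apply/span_subvP => _ /mapP[l _ ->].
have dim_spA : \dim spA = d.+1.
  suff /eqP -> : free [seq A ^+ i | i <- iota 0 d.+1] by rewrite size_map size_iota.
  have size_s : size [seq A ^+ i | i <- iota 0 d.+1] == d.+1.
    by rewrite size_map size_iota.
  apply/(@freeP _ _ _ (Tuple size_s)) => a a0.
  pose f : {poly R} := \poly_(i < d.+1) a (inord i).
  have f0 : f = 0.
    apply: (pevalmx_low_eq0 symA specA); first exact: size_poly.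
    rewrite /f poly_def pevalmx_sum -[RHS]a0; apply: eq_bigr => i _.
    by rewrite pevalmxZ pevalmxXn inord_val (nth_map 0%N) ?size_iota // nth_iota.
  move=> i; have := coef_poly d.+1 (fun i => a (inord i)) i.
  by rewrite -/f f0 coef0 ltn_ord inord_val.
have dim_V : (\dim V <= D.+1)%N.
  by apply: leq_trans (dim_span _) _; rewrite size_map size_iota.
have Dd : D = d.
  apply/eqP; rewrite eqn_leq diam_le_d -ltnS -dim_spA.
  exact: leq_trans (dimvS sub_V) dim_V.
split=> //; suff -> : spA = V by apply: Dm_V.
by apply/eqP; rewrite eqEdim sub_V dim_spA -Dd.
Qed.

Lemma sum_diam (V : nmodType) (F : 'I_d.+1 -> V) : D = d ->
  \sum_(i < d.+1 | (D <= i)%N) F i = F ord_max.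
Proof.
move=> ->.
by apply: big_pred1 => i; rewrite /= -val_eqE /= eqn_leq leq_ord.
Qed.

(** A_d is a polynomial in A orthogonal to p_i(A) for i < d, hence A_d = c p_d(A);
comparing <A_d, A_d> = <A_d, p_d(A)> gives c = 1. *)
Lemma distance_regular_excess : distance_regular e ->
  D = d /\ Dm D = pevalmx (p ord_max) A.
Proof.
move=> /diam_distance_regular[Dd /mem_adjacency_algebra[f Df]]; split=> //.
have [c Dc] : exists c, Dm D = c *: pevalmx (p ord_max) A.
  rewrite {1}Df (pevalmx_fourier symA specA predA) (bigD1 ord_max) //=.
  eexists; rewrite big1 ?addr0 // => i i_max.
  rewrite mxdotE // -Df mdot_distmx_low ?mul0r ?scale0r // size_p Dd.
  by rewrite ltn_neqAle leq_ord andbT.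
have m_avg := mdot_distmx_excess; rewrite sum_diam // in m_avg.
have m_neq0 : mdot (Dm D) (pevalmx (p ord_max) A) != 0.
  by rewrite m_avg gt_eqF ?average_far_gt0.
move: m_avg; rewrite -mdot_distmx {3}Dc mdotZr -{1}[mdot _ _]mul1r.
by move/(mulIf m_neq0) => c1; rewrite Dc -c1 scale1r.
Qed.

Lemma sum_head (F : 'I_d.+1 -> R) :
  \sum_i F i = \sum_(i < d.+1 | (i < d)%N) F i + F ord_max.
Proof.
rewrite (bigID (fun i : 'I_d.+1 => (i < d)%N)) /=; congr (_ + _).
by apply: big_pred1 => i; rewrite /= -leqNgt -val_eqE /= eqn_leq leq_ord.
Qed.

Local Notation q := (\sum_(i < d.+1 | (i < d)%N) p i).

Lemma horner_head : q.[k%:R] = n - (p ord_max).[k%:R].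
Proof.
have := horner_sum_predistance symA specA predA X_gt0 mult0.
by rewrite sum_head horner_sum lam0 => <-; rewrite addrK.
Qed.

Lemma near_gt0 x : 0 < n - far x.
Proof.
rewrite subr_gt0 ltr_nat; apply: proper_card; apply/properP; split.
  exact/subset_predT.
have dist0 : gdist e x x = 0%N by apply/eqP; rewrite gdist_eq0.
by exists x => //; rewrite inE dist0 eq_sym -lt0n diam_gt0.
Qed.

(** The equality case of Cauchy-Schwarz on the rows of r = q(A), in the form of a
vanishing sum of squares: a x is the value that r would take on row x if it
were constant on the vertices at distance < d, and the squared deviations from
it add up to n q(k) - q(k)^2 * sum_x (n - far x)^-1, which is 0. *)
Lemma harmonic_constant : D = d ->
  n / (\sum_x (n - far x)^-1) = q.[k%:R] -> forall x y, far x = far y.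
Proof.
move=> Dd harm; set Q := q.[k%:R] in harm.
have sum_gt0 : 0 < \sum_x (n - far x)^-1.
  have /card_gt0P[x _] := X_gt0.
  rewrite (bigD1 x) //= ltr_pwDl ?invr_gt0 ?near_gt0 // sumr_ge0 // => y _.
  by rewrite invr_ge0 ltW ?near_gt0.
have Q0 : Q != 0 by rewrite -harm mulf_neq0 ?invr_eq0 ?gt_eqF.
have Qsum : Q * \sum_x (n - far x)^-1 = n by rewrite -harm divfK ?gt_eqF.
pose r := pevalmx q A; pose a x := Q / (n - far x).
have far_r i j : dist i j == d -> r i j = 0.
  move=> /eqP dist_d; rewrite pevalmx_far0 // dist_d.
  apply: leq_trans (size_sum _ _ _) _; apply/bigmax_leqP => l lt_ld.
  by rewrite size_p.
have norm_r : \sum_i \sum_j r i j * r i j = n * Q.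
  have [_ orth norm_p] := predA.
  have : mdot r r = Q; last by move=> <-; rewrite mulVKf ?gt_eqF.
  rewrite {1}/r pevalmx_sum mdot_suml [RHS]horner_sum; apply: eq_bigr => i lt_id.
  rewrite mdotC /r pevalmx_sum mdot_suml (bigD1 i) //= big1 => [|j /andP[_ ji]].
    by rewrite addr0 -mxdotE // norm_p lam0.
  by rewrite -mxdotE // orth.
pose t i j := (1 - Dm D i j) * (r i j - a (enum_val i)) ^+ 2.
have t_ge0 i j : 0 <= t i j.
  by rewrite mulr_ge0 ?sqr_ge0 // mxE; case: (_ == _); rewrite ?subrr ?subr0.
have row_t i : \sum_j t i j =
    \sum_j r i j * r i j - Q ^+ 2 * (n - far (enum_val i))^-1.
  have tE j : t i j = r i j * r i j - (2 * a (enum_val i)) * r i j +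
      a (enum_val i) ^+ 2 * (1 - Dm D i j).
    rewrite /t mxE Dd; case: (boolP (_ == _)) => [/far_r ->|_]; rewrite /=; ring.
  under eq_bigr do rewrite tE.
  rewrite big_split sumrB /= -!mulr_sumr sumrB distmx_row_sum sumr_const card_ord.
  rewrite (pevalmx_row_sum sym_e reg_e) -/Q /a; field.
  by rewrite gt_eqF ?near_gt0.
have sum_t : \sum_i \sum_j t i j = 0.
  under eq_bigr do rewrite row_t.
  rewrite sumrB norm_r -mulr_sumr (sum_enum_val (fun x => (n - far x)^-1)).
  by rewrite expr2 -mulrA Qsum mulrC subrr.
have r_near i j : dist i j != d -> r i j = a (enum_val i).
  move=> near_ij; move/eqP: sum_t.
  rewrite psumr_eq0 => [/allP/(_ i (mem_index_enum i))/=|? _]; last exact: sumr_ge0.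
  rewrite psumr_eq0 => [/allP/(_ j (mem_index_enum j))/=|? _]; last exact: t_ge0.
  by rewrite /t mxE Dd (negbTE near_ij) subr0 mul1r sqrf_eq0 subr_eq0 => /eqP.
have adj x y : e x y -> far x = far y.
  (* For d = 1 neighbours are at distance d, outside the support of r; but then
     far x is the valency. *)
  move=> e_xy; have [d1|d1] := eqVneq d 1%N.
    rewrite Dd d1; congr (_%:R).
    have sph1 z : #|sphere e 1 z| = k.
      by rewrite -(reg_e z); apply: eq_card => w; rewrite !inE gdist_eq1.
    by rewrite !sph1.
  have symr : r^T = r := tr_pevalmx q symA.
  have axy : a x = a y.
    rewrite -[x]enum_rankK -[y]enum_rankK.
    rewrite -(r_near _ (enum_rank y)) -?(r_near _ (enum_rank x)) ?enum_rankK.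
    - by rewrite -[in LHS]symr mxE.
    - by apply: contraNneq d1 => <-; rewrite gdist_eq1 // sym_e.
    - by apply: contraNneq d1 => <-; rewrite gdist_eq1.
  by move: axy => /(mulfI Q0)/invr_inj/addrI/oppr_inj.
move=> x y; have /connectP[w e_w ->] := conn_e x y.
by elim: w x e_w => //= z w IH x /andP[/adj -> /IH].
Qed.

Lemma distance_regular_harmonic : distance_regular e <->
  D = d /\ n / (\sum_x (n - far x)^-1) = q.[k%:R].
Proof.
have harm_const c : (forall x, far x = c) -> n / (\sum_x (n - far x)^-1) = n - c.
  move=> far_c; under eq_bigr do rewrite far_c.
  by rewrite sumr_const -[X in n / X]mulr_natl invfM mulrA invrK mulfV ?mul1r ?gt_eqF.
split=> [/distance_regular_excess[Dd D_pd]|[Dd harm]].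
  split=> //; rewrite horner_head; apply: harm_const => x.
  rewrite -(pevalmx_row_sum sym_e reg_e _ (enum_rank x)) -D_pd distmx_row_sum.
  by rewrite enum_rankK.
apply/distance_regular_of_polynomials/predistance_distmx => //.
have /card_gt0P[x0 _] := X_gt0.
have far_c x : far x = far x0 := harmonic_constant Dd harm x x0.
have := excess_eq.1; rewrite !sum_diam //; apply.
rewrite (eq_bigr (fun=> far x0)) // sumr_const -[X in _ * X]mulr_natl mulKf ?gt_eqF //.
by move: harm; rewrite (harm_const _ far_c) horner_head => /addrI/oppr_inj.
Qed.

Lemma distance_regular_average : distance_regular e <->
  D = d /\ n^-1 * \sum_x (n - far x) = n - (p ord_max).[k%:R].
Proof.
rewrite average_near; split=> [/distance_regular_excess[Dd D_pd]|[Dd]].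
  split=> //; have := excess_eq.2; rewrite !sum_diam // => -> //.
move/addrI/oppr_inj => avg.
apply/distance_regular_of_polynomials/predistance_distmx => //.
by have := excess_eq.1; rewrite !sum_diam //; apply.
Qed.

End SpectralExcess.

Theorem corollary2p2 (R : rcfType) (X : finType) (e : rel X) (k d : nat)
    (lam : 'I_d.+1 -> R) (p : 'I_d.+1 -> {poly R}) :
  (2 <= #|X|)%N ->
  symmetric e -> irreflexive e -> (forall x y, connect e x y) ->
  (forall x, #|[set y | e x y]| = k) ->
  let A := adjmx e R in
  is_spectrum A lam -> lam ord0 = k%:R ->
  predistance A lam p ->
  let D := diam e in
  let n : R := #|X|%:R in
  let Gam (i : nat) (x : X) : R := #|sphere e i x|%:R in
  let m (i : 'I_d.+1) : R := (mult A (lam i))%:R in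
  let pd : {poly R} := p ord_max in
  let q : {poly R} := \sum_(i < d.+1 | (i < d)%N) p i in
  let spA := <<[seq A ^+ i | i <- iota 0 d.+1]>>%VS in
  let spec : R :=
    n * (1 - (\sum_(i < d.+1) (phi lam ord0) ^+ 2 / (m i * (phi lam i) ^+ 2))^-1) in
  (* (i) *)
  (n^-1 * \sum_(x : X) (n - Gam D x)
     >= n - \sum_(i < d.+1 | (D <= i)%N) (p i).[k%:R]
   /\ (n^-1 * \sum_(x : X) (n - Gam D x)
         = n - \sum_(i < d.+1 | (D <= i)%N) (p i).[k%:R]
       <-> distmx e R D = \sum_(i < d.+1 | (D <= i)%N) pevalmx (p i) A))
  (* (ii) *)
  /\ (distmx e R D \in spA ->
      forall x : X, Gam D x <= \sum_(i < d.+1 | (D <= i)%N) (p i).[k%:R])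
  (* (iii) *)
  /\ (n^-1 * \sum_(x : X) (n - Gam D x)
        = n - \sum_(i < d.+1 | (D <= i)%N) (p i).[k%:R] ->
      distmx e R D \in spA)
  (* (iv) *)
  /\ [/\ q.[k%:R] = n - pd.[k%:R] /\ n - pd.[k%:R] = spec,
      distance_regular e <->
        D = d /\
        [/\ n / (\sum_(x : X) (n - Gam d x)^-1) = q.[k%:R],
            q.[k%:R] = n - pd.[k%:R]
          & n - pd.[k%:R] = spec]
    & distance_regular e <->
        D = d /\
        (n^-1 * \sum_(x : X) (n - Gam D x) = n - pd.[k%:R]
         /\ n - pd.[k%:R] = spec)].
Proof.
move=> X_ge2 sym_e irr_e conn_e reg_e A specA lam0 predA D n Gam m pd q spA spec.
have X_gt0 : (0 < #|X|)%N := ltnW X_ge2.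
have symA : A^T = A := tr_adjmx R sym_e.
have mult0 := mult_lam0 sym_e conn_e reg_e X_gt0 specA lam0.
have avg : n^-1 * \sum_(x : X) (n - Gam D x) = n - n^-1 * \sum_(x : X) Gam D x.
  exact: average_near.
have gap_eq := excess_eq X_ge2 sym_e conn_e reg_e specA lam0 predA.
have q_k : q.[k%:R] = n - pd.[k%:R].
  exact: (horner_head X_ge2 sym_e conn_e reg_e specA lam0 predA).
have pd_spec : n - pd.[k%:R] = spec.
  by rewrite -lam0; apply: (predistance_last_spec symA specA predA X_gt0 mult0).
have avg_eq : n^-1 * \sum_(x : X) (n - Gam D x)
    = n - \sum_(i < d.+1 | (D <= i)%N) (p i).[k%:R] <->
    distmx e R D = \sum_(i < d.+1 | (D <= i)%N) pevalmx (p i) A.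
  by rewrite avg -gap_eq; split=> [/addrI/oppr_inj|->].
split; [split=> // | split; [|split; [|split]]].
- rewrite avg lerD2l lerN2.
  exact: (excess_le X_ge2 sym_e conn_e reg_e specA lam0 predA).
- move=> D_spA x.
  exact: (excess_pointwise X_ge2 sym_e conn_e reg_e specA lam0 predA).
- move/avg_eq => D_eq; apply/(mem_adjacency_algebra sym_e specA).
  by exists (\sum_(i < d.+1 | (D <= i)%N) p i); rewrite pevalmx_sum.
- by [].
- apply: iff_trans
    (distance_regular_harmonic X_ge2 sym_e irr_e conn_e reg_e specA lam0 predA) _.
  split=> -[Dd]; rewrite [diam e]Dd; first by move=> harm; split.
  by case=> harm _ _; split.
- apply: iff_trans
    (distance_regular_average X_ge2 sym_e irr_e conn_e reg_e specA lam0 predA) _.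
  by split=> [[Dd ?]|[Dd [? _]]].
Qed.
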